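(* Let $(a(n))_{n\ge 0}$ be a real recurrence sequence which is not eventually zero. Suppose that $(a(n))$ has at most four dominating characteristic roots and that none of its dominating characteristic roots is a positive real number. Then there are infinitely many $n$ with $a(n)>0$ and infinitely many $n$ with $a(n)<0$.
   Context: A (real) recurrence sequence is a sequence $(a(n))_{n\ge0}$ of real numbers satisfying a linear recurrence $a(n+d)=s_1a(n+d-1)+\dots+s_{d-1}a(n+1)+s_da(n)$ for all $n\in\mathbb{N}$, with constant real coefficients $s_1,\dots,s_d$. Writing $\alpha_1,\dots,\alpha_s$ for the distinct roots of the characteristic polynomial $z^d-s_1z^{d-1}-\dots-s_{d-1}z-s_d$, the sequence can be written uniquely as a generalized power sum $a(n)=C_1(n)\alpha_1^n+\dots+C_s(n)\alpha_s^n$ with polynomials $C_k$ with complex coefficients. The characteristic roots of $(a(n))$ are those $\alpha_k$ with $C_k\neq 0$; the dominating characteristic roots are the characteristic roots of maximal modulus. *)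

(* Defs.v *)
From HB Require Import structures.
From mathcomp Require Import all_boot all_order all_algebra.
From mathcomp Require Import reals.
From mathcomp Require Import complex.

Set Implicit Arguments.
Unset Strict Implicit.
Unset Printing Implicit Defensive.

Import Order.TTheory GRing.Theory Num.Theory.
Local Open Scope ring_scope.
Local Open Scope complex_scope.

(* The coefficient s_(i+1) of the recurrence is [s i], for i = 0, ..., d-1. *)
Definition satisfies_rec (R : realType) (d : nat) (s : 'I_d -> R)
    (a : nat -> R) : Prop :=
  forall n : nat, a (n + d)%N = \sum_(i < d) s i * a (n + (d - i.+1))%N.

Definition rec_charpoly (R : realType) (d : nat) (s : 'I_d -> R) : {poly R} :=
  'X^d - \sum_(i < d) s i *: 'X^(d - i.+1).

Definition rec_charpolyC (R : realType) (d : nat) (s : 'I_d -> R) :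
    {poly R[i]} :=
  map_poly (real_complex R) (rec_charpoly s).

Definition distinct_roots (F : closedFieldType) (p : {poly F}) : seq F :=
  undup (sval (closed_field_poly_normal p)).

Lemma mem_distinct_roots (F : closedFieldType) (p : {poly F}) (z : F) :
  p != 0 -> (z \in distinct_roots p) = root p z.
Proof.
rewrite /distinct_roots mem_undup.
case: closed_field_poly_normal => r /= -> nz.
by rewrite rootZ ?root_prod_XsubC //; apply: contraNneq nz => ->; rewrite scale0r.
Qed.

(* [C z] is the polynomial coefficient attached to the root z.  If the last
   coefficient of the recurrence is nonzero, 0 is not a root, its multiplicity
   is 0, and this is the expansion over all roots, valid for all n.  Otherwise
   the root 0, of multiplicity m, only affects the terms a(0), ..., a(m-1),
   which a summand C(n) 0^n cannot represent in general: it contributes nothing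
   to the expansion, which then holds for n >= m. *)
Definition power_sum_expansion (R : realType) (d : nat) (s : 'I_d -> R)
    (a : nat -> R) (C : R[i] -> {poly R[i]}) : Prop :=
  forall n : nat, (mup 0 (rec_charpolyC s) <= n)%N ->
    (a n)%:C = \sum_(z <- distinct_roots (rec_charpolyC s) | z != 0)
                 (C z).[n%:R] * z ^+ n.

Definition characteristic_root (R : realType) (d : nat) (s : 'I_d -> R)
    (a : nat -> R) (z : R[i]) : Prop :=
  [/\ z \in distinct_roots (rec_charpolyC s), z != 0
    & exists2 C : R[i] -> {poly R[i]},
        power_sum_expansion s a C & C z != 0].

Definition dominating_root (R : realType) (d : nat) (s : 'I_d -> R)
    (a : nat -> R) (z : R[i]) : Prop :=
  characteristic_root s a z /\
  forall w : R[i], characteristic_root s a w -> `|w| <= `|z|.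

Definition eventually_zero (R : realType) (a : nat -> R) : Prop :=
  exists N : nat, forall n : nat, (N <= n)%N -> a n = 0.

(* Main.v *)
Require Import Defs.
From HB Require Import structures.
From mathcomp Require Import all_boot all_order all_algebra.
From mathcomp Require Import reals boolp.
From mathcomp Require Import complex.
From mathcomp Require Import ring lra zify.

Set Implicit Arguments.
Unset Strict Implicit.
Unset Printing Implicit Defensive.

Import Order.TTheory GRing.Theory Num.Theory.
Local Open Scope ring_scope.
Local Open Scope complex_scope.

(** Suppose [a n >= 0] eventually, and let [rho] be the modulus of the dominating
    characteristic roots.  A complex number [z] that is not a nonnegative real is
    a root of a real polynomial [g] with nonnegative coefficients and [g`_0 > 0].
    With E the shift, [g(E) a] is again nonnegative, it bounds [g`_0 * a], and the
    multiplicity of [z] has dropped.  If no dominating root is positive, all of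
    them can be removed in this way, so that [a n = O(sigma ^+ n)] for some
    [sigma < rho].  But for a dominating root [w] some [h(E) a] is
    [c * w ^+ n] with [c != 0], a contradiction.  The uniqueness of the
    power sum expansion is not needed, because the argument is applied to an
    expansion witnessing a characteristic root of maximal modulus. *)

(** * Polynomials in the shift acting on sequences *)

(* [poly_act p a] is p(E) a, where E is the shift a(n) |-> a(n+1). *)
Definition poly_act (K : comNzRingType) (p : {poly K}) (a : nat -> K)
    (n : nat) : K :=
  \sum_(i < size p) p`_i * a (n + i)%N.

Lemma poly_act_leq (K : comNzRingType) (p : {poly K}) a N n :
  (size p <= N)%N -> poly_act p a n = \sum_(i < N) p`_i * a (n + i)%N.
Proof.
move=> le_pN; rewrite /poly_act (big_ord_widen N (fun i => p`_i * a (n + i)%N)) //.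
rewrite big_mkcond /=; apply: eq_bigr => i _.
by case: ltnP => // le_pi; rewrite nth_default // mul0r.
Qed.

Lemma eq_poly_act (K : comNzRingType) (p : {poly K}) a b :
  a =1 b -> poly_act p a =1 poly_act p b.
Proof. by move=> eq_ab n; apply: eq_bigr => i _; rewrite eq_ab. Qed.

Lemma poly_actD (K : comNzRingType) (p q : {poly K}) a n :
  poly_act (p + q) a n = poly_act p a n + poly_act q a n.
Proof.
set N := maxn (size p) (size q).
rewrite !(@poly_act_leq _ _ _ N) ?leq_maxl ?leq_maxr ?size_polyD //.
by rewrite -big_split /=; apply: eq_bigr => i _; rewrite coefD mulrDl.
Qed.

Lemma poly_actC (K : comNzRingType) (c : K) a n :
  poly_act c%:P a n = c * a n.
Proof.
by rewrite (@poly_act_leq _ _ _ 1) ?size_polyC_leq1 // big_ord1 coefC addn0.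
Qed.

Lemma poly_act0 (K : comNzRingType) (p : {poly K}) a :
  a =1 (fun=> 0) -> poly_act p a =1 (fun=> 0).
Proof. by move=> a0 n; apply: big1 => i _; rewrite a0 mulr0. Qed.

Lemma poly_act_mulX (K : comNzRingType) (p : {poly K}) a n :
  poly_act (p * 'X) a n = poly_act p a n.+1.
Proof.
rewrite (@poly_act_leq _ _ _ (size p).+1); last first.
  have [->|p0] := eqVneq p 0; first by rewrite mul0r size_poly0.
  by rewrite size_mulX.
rewrite big_ord_recl coefMX eqxx mul0r add0r /poly_act.
by apply: eq_bigr => i _; rewrite coefMX /= addSnnS.
Qed.

Lemma poly_actCM (K : comNzRingType) (c : K) (p : {poly K}) a n :
  poly_act (c%:P * p) a n = c * poly_act p a n.
Proof.
rewrite (@poly_act_leq _ _ _ (size p)); last first.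
  by rewrite mul_polyC size_scale_leq.
by rewrite mulr_sumr; apply: eq_bigr => i _; rewrite coefCM mulrA.
Qed.

Lemma poly_actM (K : comNzRingType) (p q : {poly K}) a n :
  poly_act (p * q) a n = poly_act p (poly_act q a) n.
Proof.
elim/poly_ind: p n => [|p c IH] n; first by rewrite mul0r -polyC0 !poly_actC !mul0r.
rewrite mulrDl !poly_actD poly_actCM poly_actC; congr (_ + _).
by rewrite mulrAC !poly_act_mulX IH.
Qed.

Lemma poly_actMC (K : comNzRingType) (p q : {poly K}) a n :
  poly_act (p * q) a n = poly_act q (poly_act p a) n.
Proof. by rewrite mulrC poly_actM. Qed.

Lemma poly_act_XsubC (K : comNzRingType) (z : K) a n :
  poly_act ('X - z%:P) a n = a n.+1 - z * a n.
Proof.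
rewrite -polyCN poly_actD poly_actC mulNr -['X]mul1r poly_act_mulX -polyC1.
by rewrite poly_actC mul1r.
Qed.

Lemma poly_act_Xn (K : comNzRingType) (p : {poly K}) m a n :
  poly_act (p * 'X^m) a n = poly_act p a (n + m)%N.
Proof.
elim: m n => [|m IH] n; first by rewrite mulr1 addn0.
by rewrite exprSr mulrA poly_act_mulX IH addSnnS.
Qed.

Lemma poly_act_seq_sum (K : comNzRingType) (p : {poly K}) (I : Type) (r : seq I)
    (F : I -> nat -> K) n :
  poly_act p (fun k => \sum_(i <- r) F i k) n = \sum_(i <- r) poly_act p (F i) n.
Proof.
by rewrite /poly_act exchange_big; apply: eq_bigr => i _; rewrite mulr_sumr.
Qed.

Lemma poly_act_shift (K : comNzRingType) (p : {poly K}) a m n :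
  poly_act p (fun k => a (k + m)%N) n = poly_act p a (n + m)%N.
Proof. by apply: eq_bigr => i _; rewrite addnAC. Qed.

Lemma poly_act_map (K L : comNzRingType) (f : {rmorphism K -> L}) (p : {poly K}) a n :
  poly_act (map_poly f p) (fun k => f (a k)) n = f (poly_act p a n).
Proof.
rewrite (@poly_act_leq _ _ _ (size p)) ?size_poly // /poly_act rmorph_sum.
by apply: eq_bigr => i _; rewrite coef_map rmorphM.
Qed.

(** * The action of E - z on a single term C(n) w^n *)

(** E - z maps the sequence C(n) w^n to D(n) w^n, where D is this polynomial. *)
Definition twist (K : comNzRingType) (z w : K) (C : {poly K}) : {poly K} :=
  w *: (C \Po ('X + 1)) - z *: C.

Lemma poly_act_monomial (K : comNzRingType) (z w : K) (C : {poly K}) n :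
  poly_act ('X - z%:P) (fun k => C.[k%:R] * w ^+ k) n
    = (twist z w C).[n%:R] * w ^+ n.
Proof.
rewrite poly_act_XsubC /twist hornerD hornerN !hornerZ horner_comp hornerD hornerX.
by rewrite hornerC -natr1 exprS; ring.
Qed.

(** Substituting X + 1 preserves the leading coefficient. Hence twisting keeps the degree if z
    differs from w and lowers it if z = w. *)
Lemma twist_lead (K : idomainType) (z w : K) (C : {poly K}) :
  (twist z w C)`_(size C).-1 = (w - z) * lead_coef C.
Proof.
have sX1 : size ('X + 1 : {poly K}) = 2 by rewrite size_XaddC.
rewrite /twist coefB !coefZ mulrBl; congr (_ * _ - _).
rewrite -{1}(size_comp_poly2 C sX1) -[LHS]/(lead_coef (C \Po ('X + 1))) lead_coef_comp ?sX1 //.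
by rewrite lead_coefXaddC expr1n mulr1.
Qed.

Lemma size_twist (K : idomainType) (z w : K) (C : {poly K}) :
  (size (twist z w C) <= size C)%N.
Proof.
have sX1 : size ('X + 1 : {poly K}) = 2 by rewrite size_XaddC.
rewrite (leq_trans (size_polyD _ _)) // geq_max size_polyN.
rewrite (leq_trans (size_scale_leq _ _)) ?(leq_trans (size_scale_leq _ _)) //.
by rewrite size_comp_poly2.
Qed.

Lemma size_twist_diag (K : idomainType) (w : K) (C : {poly K}) k :
  (size C <= k.+1)%N -> (size (twist w w C) <= k)%N.
Proof.
move=> sC; apply/leq_sizeP => j le_kj.
have := size_twist w w C; have := twist_lead w w C; rewrite subrr mul0r => lc st.
have [/eqP|ne] := eqVneq j (size C).-1; first by move/eqP => ->.
apply/(leq_sizeP _ _ st); move: ne sC; case: (size C) => //= m; lia.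
Qed.

Lemma horner_nat_eq0 (K : numFieldType) (C : {poly K}) :
  (forall n : nat, C.[n%:R] = 0) -> C = 0.
Proof.
move=> C0; apply: (@roots_geq_poly_eq0 _ _ [seq i%:R | i <- iota 0 (size C)]).
- by apply/allP => x /mapP [i _ ->]; rewrite /root C0.
- by rewrite map_inj_uniq ?iota_uniq // => i j /eqP; rewrite eqr_nat => /eqP.
- by rewrite size_map size_iota.
Qed.

(** * Existence of power sum expansions *)

Lemma coef_Xadd1n (K : comNzRingType) n i :
  (('X + 1 : {poly K}) ^+ n)`_i = 'C(n, i)%:R.
Proof.
rewrite addrC exprDn coef_sum.
rewrite (eq_bigr (fun j : 'I_n.+1 => if j == i :> nat then 'C(n, j)%:R else 0)); last first.
  by move=> j _; rewrite expr1n mul1r coefMn coefXn eq_sym; case: eqP; rewrite ?mul0rn.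
rewrite -big_mkcond /=; case: (ltnP i n.+1) => [lt_in|lt_ni].
  by rewrite (big_pred1 (Ordinal lt_in)).
rewrite big_pred0 ?bin_small // => j; apply/negbTE/eqP => eq_ji.
by have := ltn_ord j; rewrite eq_ji; lia.
Qed.

Lemma twistD (K : comNzRingType) (z w : K) C D :
  twist z w (C + D) = twist z w C + twist z w D.
Proof. by rewrite /twist comp_polyD !scalerDr; ring. Qed.

(** Induction on a bound for the size of C: the top coefficient is matched by the twist of a
    monomial, and the remainder is smaller. *)
Lemma twist_surj (K : numFieldType) (z w : K) (C : {poly K}) :
  w != 0 -> exists D, twist z w D = C.
Proof.
move=> w0; have [n] := ubnP (size C); elim: n => // n IH in C * => /ltnSE sC.
case: n => [|n] in IH sC *.
  exists 0; rewrite /twist comp_poly0 !scaler0 subr0.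
  by move: sC; rewrite leqn0 size_poly_eq0 => /eqP.
suff [D sD cD] : exists2 D, (size (twist z w D) <= n.+1)%N & (twist z w D)`_n = C`_n.
  have [|E TE] := IH (C - twist z w D).
    rewrite ltnS; apply/leq_sizeP => j le_nj; rewrite coefB.
    have [<-|ne] := eqVneq n j; first by rewrite cD subrr.
    have lt_nj: (n < j)%N by rewrite ltn_neqAle ne.
    by rewrite (leq_sizeP _ _ sC) // (leq_sizeP _ _ sD) // subrr.
  by exists (E + D); rewrite twistD TE subrK.
have coefT c k i : (twist z w (c *: 'X^k))`_i = c * (w * 'C(k, i)%:R - z * (i == k)%:R).
  by rewrite /twist comp_polyZ comp_Xn_poly coefB !coefZ coef_Xadd1n coefXn; ring.
have [zw|zw] := eqVneq z w.
  (* For z = w the twist of X^(n+1) has degree n and leading coefficient w (n+1), which is nonzero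
     in characteristic 0. *)
  subst z; have ne0 : w * n.+1%:R != 0 by rewrite mulf_neq0 ?pnatr_eq0.
  exists ((C`_n / (w * n.+1%:R)) *: 'X^(n.+1)).
    apply/leq_sizeP => j le_nj; rewrite coefT.
    have [->|ne] := eqVneq j n.+1; first by rewrite binn subrr mulr0.
    by rewrite bin_small ?mulr0 ?subrr ?mulr0 // ltn_neqAle eq_sym ne.
  by rewrite coefT binSn (ltn_eqF (ltnSn n)) mulr0 subr0 divfK.
(* For z different from w the twist of X^n has leading coefficient w - z. *)
have ne0 : w - z != 0 by rewrite subr_eq0 eq_sym.
exists ((C`_n / (w - z)) *: 'X^n).
  apply/leq_sizeP => j le_nj; rewrite coefT.
  by rewrite bin_small // gtn_eqF // !mulr0 subrr mulr0.
by rewrite coefT binn eqxx !mulr1 divfK.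
Qed.

(** Induction on [r], in which roots may repeat, while the list [S] of available roots stays fixed.
    A power sum for (E - z) a is lifted through E - z term by term. *)
Lemma power_sum_exists (K : numFieldType) (S r : seq K) (a : nat -> K) :
  uniq S -> 0 \notin S -> {subset r <= S} ->
  poly_act (\prod_(z <- r) ('X - z%:P)) a =1 (fun=> 0) ->
  exists C : K -> {poly K}, forall n, a n = \sum_(w <- S) (C w).[n%:R] * w ^+ n.
Proof.
move=> uS S0; elim: r => [|z r IH] in a * => rS.
  move=> a0; exists (fun=> 0) => n; move: (a0 n); rewrite big_nil poly_actC mul1r => ->.
  by rewrite big1 // => w _; rewrite horner0 mul0r.
rewrite big_cons => ann.
have [||C bE] := IH (poly_act ('X - z%:P) a).
- by move=> w rw; apply: rS; rewrite inE rw orbT.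
- by move=> n; rewrite -poly_actMC ann.
have [D DE] : exists D : K -> {poly K}, forall w, w != 0 -> twist z w (D w) = C w.
  suff /choice [D DE] : forall w, exists D, w != 0 -> twist z w D = C w by exists D.
  move=> w; have [->|w0] := eqVneq w 0; first by exists 0.
  by have [D ?] := twist_surj z (C w) w0; exists D.
pose f n := \sum_(w <- S) (D w).[n%:R] * w ^+ n.
have fE n : f n.+1 - z * f n = a n.+1 - z * a n.
  rewrite -!poly_act_XsubC bE /f poly_act_seq_sum; apply: eq_big_seq => w wS.
  by rewrite poly_act_monomial DE //; apply: contraNneq S0 => <-.
(* The difference u = a - f satisfies u(n+1) = z u(n), so it is a multiple of z^n. This goes into
   the constant coefficient of the term of z. *)
have aE n : a n = (a 0%N - f 0%N) * z ^+ n + f n.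
  elim: n => [|n IHn]; first by rewrite mulr1 subrK.
  by rewrite -[a n.+1](subrK (z * a n)) -fE IHn exprS; ring.
have zS : z \in S by apply: rS; rewrite mem_head.
exists (fun w => D w + (if w == z then a 0%N - f 0%N else 0)%:P) => n.
under eq_bigr do rewrite hornerD hornerC mulrDl.
rewrite big_split /= addrC {1}aE; congr (_ + _).
rewrite (bigD1_seq z) //= eqxx big1 ?addr0 // => w /negbTE ->.
by rewrite mul0r.
Qed.

(** * Annihilating and isolating terms of a power sum *)

Lemma poly_act_kill (K : idomainType) (w : K) (C : {poly K}) k :
  (size C <= k)%N ->
  poly_act (('X - w%:P) ^+ k) (fun n => C.[n%:R] * w ^+ n) =1 (fun=> 0).
Proof.
elim: k => [|k IH] in C *.
  rewrite leqn0 size_poly_eq0 => /eqP -> n.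
  by apply: poly_act0 => m; rewrite horner0 mul0r.
move=> sC n; rewrite exprS poly_actMC (eq_poly_act _ (poly_act_monomial w w C)).
by rewrite IH // size_twist_diag.
Qed.

Lemma poly_act_power_sum_kill (K : idomainType) (S : seq K) (C : K -> {poly K}) :
  poly_act (\prod_(z <- S) ('X - z%:P) ^+ size (C z))
    (fun n => \sum_(w <- S) (C w).[n%:R] * w ^+ n) =1 (fun=> 0).
Proof.
move=> n; rewrite poly_act_seq_sum big1_seq // => w /andP [_ wS].
rewrite (big_rem w) //= poly_actMC; apply: poly_act0; exact: poly_act_kill.
Qed.

(** For z different from w, twisting multiplies the leading coefficient by w - z, so the term of w
    survives every power of E - z. *)
Lemma poly_act_off_diag (K : idomainType) (z w : K) (C : {poly K}) k :
  z != w -> C != 0 ->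
  exists2 D, D != 0 & poly_act (('X - z%:P) ^+ k) (fun n => C.[n%:R] * w ^+ n)
                      =1 (fun n => D.[n%:R] * w ^+ n).
Proof.
move=> zw; elim: k => [|k IH] in C * => C0.
  by exists C => // n; rewrite poly_actC mul1r.
have T0 : twist z w C != 0.
  apply: contra_neq C0 => T0; have /eqP := twist_lead z w C.
  rewrite T0 coef0 eq_sym mulf_eq0 subr_eq0 eq_sym (negbTE zw) /= lead_coef_eq0.
  by move/eqP.
have [D D0 DE] := IH _ T0; exists D => // n.
by rewrite exprS poly_actMC (eq_poly_act _ (poly_act_monomial z w C)) DE.
Qed.

Lemma poly_act_diag (K : numFieldType) (w : K) (C : {poly K}) : w != 0 -> C != 0 ->
  exists h, exists2 c, c != 0 &
    poly_act h (fun n => C.[n%:R] * w ^+ n) =1 (fun n => c * w ^+ n).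
Proof.
move=> w0; have [n] := ubnP (size C); elim: n => // n IH in C * => /ltnSE sC C0.
have [T0|T0] := eqVneq (twist w w C) 0; last first.
  have [|h [c c0 hE]] := IH _ _ T0.
    case: n sC {IH} => [|n sC]; last by rewrite ltnS size_twist_diag.
    by rewrite leqn0 size_poly_eq0 (negbTE C0).
  exists (h * ('X - w%:P)), c => // m.
  by rewrite poly_actM (eq_poly_act _ (poly_act_monomial w w C)) hE.
(* A zero twist means that E - w kills C(n) w^n, that is, C(n+1) = C(n) for all n. *)
have CE m : C.[m%:R] = C.[0].
  elim: m => // m <-; have := poly_act_monomial w w C m.
  rewrite T0 horner0 mul0r poly_act_XsubC => /eqP.
  rewrite subr_eq0 [w * _]mulrCA -exprS => /eqP.
  by move/mulIf => -> //; rewrite expf_neq0.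
exists 1, C.[0]; last by move=> m; rewrite poly_actC mul1r CE.
by apply: contraNneq C0 => C00; apply/eqP/horner_nat_eq0 => m; rewrite CE.
Qed.

(** Powers of E - z, for the other z in [S], kill all other terms without killing that of w; powers
    of E - w then reduce its coefficient to a nonzero constant. *)
Lemma poly_act_isolate (K : numFieldType) (S : seq K) (C : K -> {poly K}) w :
  uniq S -> w \in S -> w != 0 -> C w != 0 ->
  exists h, exists2 c, c != 0 &
    poly_act h (fun n => \sum_(z <- S) (C z).[n%:R] * z ^+ n) =1 (fun n => c * w ^+ n).
Proof.
move=> uS wS w0 Cw.
have [h1 [D D0 h1w] h1z] : exists2 h1 : {poly K},
  exists2 D, D != 0 & poly_act h1 (fun n => (C w).[n%:R] * w ^+ n)
                      =1 (fun n => D.[n%:R] * w ^+ n) &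
  forall z, z \in rem w S -> poly_act h1 (fun n => (C z).[n%:R] * z ^+ n) =1 (fun=> 0).
  have : w \notin rem w S by rewrite mem_rem_uniqF.
  elim: (rem w S) => [_|z s IH].
    by exists 1 => //; exists (C w) => // n; rewrite poly_actC mul1r.
  rewrite inE negb_or eq_sym => /andP [zw /IH [h1 [D D0 h1w] h1z]].
  have [E E0 hE] := poly_act_off_diag (size (C z)) zw D0.
  exists (h1 * ('X - z%:P) ^+ size (C z)).
    by exists E => // n; rewrite poly_actMC (eq_poly_act _ h1w) hE.
  move=> x; rewrite inE => /orP [/eqP ->|/h1z hx] n.
    by rewrite poly_actM; apply: poly_act0; exact: poly_act_kill.
  by rewrite poly_actMC; exact: poly_act0.
have [h2 [c c0 h2E]] := poly_act_diag w0 D0; exists (h2 * h1), c => // n.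
rewrite poly_actM -h2E; apply: eq_poly_act => k.
rewrite poly_act_seq_sum (big_rem w) //= h1w big1_seq ?addr0 // => z /andP [_ /h1z].
exact.
Qed.

(** * Geometric growth bounds *)

(** [sigma] and [M] lie in the field itself, which may be complex; the case n = 0 forces M to be a
    nonnegative real. *)
Definition geo_bounded (K : numFieldType) (sigma : K) (e : nat -> K) : Prop :=
  exists M, forall n, `|e n| <= M * sigma ^+ n.

Lemma geo_bounded_poly_act (K : numFieldType) (sigma : K) (p : {poly K}) e :
  0 < sigma -> geo_bounded sigma e -> geo_bounded sigma (poly_act p e).
Proof.
move=> s0 [M eM]; exists (\sum_(i < size p) `|p`_i| * M * sigma ^+ i) => n.
rewrite /poly_act mulr_suml (le_trans (ler_norm_sum _ _ _)) // ler_sum // => i _.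
rewrite normrM -!mulrA ler_wpM2l // (le_trans (eM _)) //.
by rewrite exprD [sigma ^+ n * _]mulrC.
Qed.

Lemma geo_bounded_rec (K : numFieldType) (sigma z : K) e :
  `|z| < sigma -> geo_bounded sigma (fun n => e n.+1 - z * e n) ->
  geo_bounded sigma e.
Proof.
move=> zs [M eM]; have d0 : 0 < sigma - `|z| by rewrite subr_gt0.
have s0 : 0 <= sigma by exact: le_trans (normr_ge0 z) (ltW zs).
have M0 : 0 <= M by have := eM 0%N; rewrite mulr1; exact: le_trans (normr_ge0 _).
(* This constant K satisfies M + |z| K <= sigma K, which is what the induction step asks for. *)
exists (`|e 0%N| + M / (sigma - `|z|)); elim=> [|n IH].
  by rewrite mulr1 lerDl divr_ge0 // ltW.
rewrite -[e n.+1](subrK (z * e n)) (le_trans (ler_normD _ _)) //.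
rewrite normrM; apply: le_trans (lerD (eM n) (ler_wpM2l (normr_ge0 z) IH)) _.
rewrite exprS !mulrA -mulrDl ler_wpM2r ?exprn_ge0 //.
set E := `|e _|; have E0 : 0 <= E by exact: normr_ge0.
have -> : M + `|z| * (E + M / (sigma - `|z|)) =
   (E + M / (sigma - `|z|)) * sigma - E * (sigma - `|z|).
  by field; rewrite gt_eqF.
by rewrite gerBl mulr_ge0 // ltW.
Qed.

Lemma geo_bounded_roots (K : numFieldType) (sigma : K) (r : seq K) e :
  0 < sigma -> (forall z, z \in r -> `|z| < sigma) ->
  poly_act (\prod_(z <- r) ('X - z%:P)) e =1 (fun=> 0) -> geo_bounded sigma e.
Proof.
move=> s0; elim: r => [|z r IH] in e * => rs ann.
  exists 0 => n; move: (ann n); rewrite big_nil poly_actC mul1r => ->.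
  by rewrite normr0 mul0r.
apply: (@geo_bounded_rec _ _ z); first by rewrite rs ?mem_head.
have [||M eM] := IH (poly_act ('X - z%:P) e).
- by move=> w rw; apply: rs; rewrite inE rw orbT.
- by move=> n; rewrite -poly_actMC -(ann n) big_cons.
by exists M => n; rewrite -poly_act_XsubC.
Qed.

Lemma expr_unbounded (R : archiRealFieldType) (t B : R) :
  1 < t -> exists n, B < t ^+ n.
Proof.
move=> t1; have d0 : 0 < t - 1 by rewrite subr_gt0.
have bernoulli n : 1 + n%:R * (t - 1) <= t ^+ n.
  elim: n => [|n IH]; first by rewrite mul0r addr0.
  rewrite exprS; apply: le_trans (ler_wpM2l _ IH); last by rewrite ltW ?(lt_trans ltr01).
  have : 0 <= n%:R * (t - 1) * (t - 1) by rewrite !mulr_ge0 // ltW.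
  rewrite -natr1; lra.
exists (Num.bound (`|B| / (t - 1))); apply: lt_le_trans (bernoulli _).
have : `|B| / (t - 1) < (Num.bound (`|B| / (t - 1)))%:R.
  by apply: archi_boundP; rewrite divr_ge0 // ltW.
rewrite ltr_pdivrMr // => hB; have := ler_norm B; lra.
Qed.

Lemma not_geo_bounded (R : realType) (sigma w c : R[i]) :
  0 < sigma -> sigma < `|w| -> c != 0 -> ~ geo_bounded sigma (fun n => c * w ^+ n).
Proof.
move=> s0 sw c0 [M hM].
have : 1 < `|w| / sigma by rewrite ltr_pdivlMr // mul1r.
(* The ratio is moved to the real field, where the archimedean property makes its powers unbounded,
   although they would be at most M / |c|. *)
have [t tE] : exists t : R, `|w| / sigma = t%:C.
  exists (complex.Re (`|w| / sigma)); apply/esym/RRe_real/ger0_real.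
  by rewrite divr_ge0 // ltW.
rewrite tE ltcR => /(expr_unbounded (complex.Re (M / `|c|))) [n].
rewrite -ltcR RRe_real; last first.
  apply: ger0_real; rewrite divr_ge0 //.
  by have := hM 0%N; rewrite !mulr1; exact: le_trans (normr_ge0 _).
rewrite rmorphXn /= -tE expr_div_n ltr_pdivlMr ?exprn_gt0 // mulrAC ltr_pdivrMr ?normr_gt0 //.
by rewrite -normrX -normrM [w ^+ n * c]mulrC (le_gtF (hM n)).
Qed.

(** * Removing roots by polynomials with nonnegative coefficients *)

(** Squaring doubles the argument. If Re z > 0 and Re z <= 2^(m+1) |Im z|, then Re z^2 <= 2^m |Im
    z^2|, so repeated squaring leaves the right half plane. *)
Lemma exists_pow_Re_le0 (R : realType) (z : R[i]) :
  ~ (0 <= z) -> exists2 k, (0 < k)%N & complex.Re (z ^+ k) <= 0.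
Proof.
move=> z0; have [Rz|Rz] := leP (complex.Re z) 0; first by exists 1%N.
have Iz : complex.Im z != 0.
  by apply/eqP => Iz; apply: z0; rewrite lecE Iz eqxx ltW.
have {z0} [m] : exists m, complex.Re z <= 2 ^+ m * `|complex.Im z|.
  have I0 : 0 < `|complex.Im z| by rewrite normr_gt0.
  exists (Num.bound (complex.Re z / `|complex.Im z|)).
  by rewrite -ler_pdivrMr // ltW // upper_nthrootP.
elim: m z Rz {Iz} => [|m IH] z Rz hm.
  exists 2%N => //; case: z Rz hm => x y /= x0; rewrite mul1r => xy.
  have : x * x <= `|y| * `|y| by apply: ler_pM => //; exact: ltW.
  by rewrite -normrM ger0_norm -?expr2 ?sqr_ge0 // subr_le0.
have [Rz2|Rz2] := leP (complex.Re (z ^+ 2)) 0; first by exists 2%N.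
have [|k k0 hk] := IH (z ^+ 2) Rz2; last first.
  by exists (2 * k)%N; [rewrite muln_gt0 | rewrite exprM].
case: z Rz hm {Rz2} => x y /= x0 hm.
have -> : x * y + y * x = 2 * x * y by ring.
rewrite !normrM (ger0_norm (ltW x0)) ger0_norm //.
have : x * x <= x * (2 ^+ m.+1 * `|y|) by rewrite ler_pM2l.
rewrite exprS; have : 0 <= y * y by rewrite -expr2 sqr_ge0.
have -> : 2 ^+ m * (2 * x * `|y|) = x * (2 * 2 ^+ m * `|y|) by ring.
lra.
Qed.

Lemma exists_nneg_poly_root (R : realType) (z : R[i]) :
  ~ (0 <= z) -> exists g : {poly R},
    [/\ forall i, 0 <= g`_i, 0 < g`_0 & root (map_poly (real_complex R) g) z].
Proof.
move=> z0; have [k k0 hk] := exists_pow_Re_le0 z0.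
have zk0 : z ^+ k != 0 by apply/expf_neq0/eqP => z00; apply: z0; rewrite z00.
case E : (z ^+ k) hk zk0 => [x y] /= x0; rewrite eq_complex /= => xy0.
have n0 : 0 < x ^+ 2 + y ^+ 2.
  rewrite lt_neqAle addr_ge0 ?sqr_ge0 // andbT eq_sym paddr_eq0 ?sqr_ge0 //.
  by rewrite !sqrf_eq0.
(* With z^k = x + iy this is (X^k - z^k) times (X^k - conj(z^k)). Its middle coefficient -2x is
   nonnegative, and its constant term is |z^k|^2 > 0. *)
exists ('X^(k * 2) + (- 2 * x) *: 'X^k + (x ^+ 2 + y ^+ 2)%:P); split.
- move=> i; rewrite !coefE; apply: addr_ge0; last by case: eqP => // _; apply: ltW.
  rewrite addr_ge0 ?ler0n // mulr_ge0 ?ler0n //; lra.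
- rewrite !coefE eqxx; case: k k0 {E} => // k _.
  by rewrite mulr0 !add0r.
rewrite /root !rmorphD /= map_polyZ !map_polyXn !map_polyC /= !hornerE /= exprM E.
by rewrite eq_complex /= !expr2 /=; apply/andP; split; apply/eqP; ring.
Qed.

(** Each root in [r] is absorbed by some g(E), which keeps the sequence nonnegative. When [r] is
    exhausted, [q] gives the bound, and it is carried back through g_0 a(n) <= (g(E) a)(n). *)
Lemma nneg_geo_bounded (R : realType) (sigma : R[i]) (q : {poly R[i]}) (r : seq R[i])
    (a : nat -> R) :
  0 < sigma ->
  (forall e, poly_act q e =1 (fun=> 0) -> geo_bounded sigma e) ->
  (forall z, z \in r -> ~ (0 <= z)) ->
  (forall n, 0 <= a n) ->
  poly_act ((\prod_(z <- r) ('X - z%:P)) * q) (fun n => (a n)%:C) =1 (fun=> 0) ->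
  geo_bounded sigma (fun n => (a n)%:C).
Proof.
move=> s0 qb; elim: r => [|z r IH] in a * => r0 a0 ann.
  by apply: qb => n; rewrite -(ann n) big_nil mul1r.
have [g [g0 g00 gz]] := exists_nneg_poly_root (r0 z (mem_head _ _)).
have [||n|M bM] := IH (poly_act g a).
- by move=> w rw; apply: r0; rewrite inE rw orbT.
- by move=> n; apply: sumr_ge0 => i _; rewrite mulr_ge0.
- have /factor_theorem [h gE] := gz.
  rewrite -(@eq_poly_act _ _ _ _ (poly_act_map (real_complex R) g a)) -poly_actM gE.
  rewrite mulrCA poly_actM; apply: poly_act0 => m.
  by rewrite -(ann m) big_cons; congr (poly_act _ _ _); ring.
exists ((g`_0)^-1%:C * M) => n; rewrite -mulrA.
have le_ag : g`_0 * a n <= poly_act g a n.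
  (* One extra term makes the range visibly nonempty, so that index 0 splits off. *)
  rewrite (@poly_act_leq _ _ _ (size g).+1) // big_ord_recl /= addn0 lerDl.
  by apply: sumr_ge0 => i _; rewrite mulr_ge0.
have := bM n; rewrite !ger0_norm ?lecR //; last first.
  by apply: sumr_ge0 => i _; rewrite mulr_ge0.
have gK : (g`_0)%:C * (g`_0)^-1%:C = 1 by rewrite -rmorphM /= mulfV ?gt_eqF.
move=> bn; rewrite -(@ler_pM2l _ (g`_0)%:C) ?ltcR // [leRHS]mulrA gK mul1r.
by apply: le_trans bn; rewrite -rmorphM lecR.
Qed.

(** * Dominating terms of nonnegative power sums *)

(** The order of K is only partial, but norms are real and hence comparable; midpoints between |z|
    and [rho] are inserted where needed. *)
Lemma exists_norm_gap (K : numFieldType) (s : seq K) (rho : K) : 0 < rho ->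
  exists sigma, [/\ 0 < sigma, sigma < rho &
    forall z, z \in s -> `|z| < rho -> `|z| < sigma].
Proof.
move=> rho0; elim: s => [|z s [t [t0 t_rho ts]]].
  by exists (rho / 2); split=> //; rewrite ?divr_gt0 ?ltr_pdivrMr ?ltr_pMr ?ltr1n.
have [zt|tz] := real_ltP (normr_real z) (gtr0_real t0).
  by exists t; split=> // x; rewrite inE => /orP [/eqP -> //|]; exact: ts.
have [z_rho|rho_z] := real_ltP (normr_real z) (gtr0_real rho0); last first.
  exists t; split=> // x; rewrite inE => /orP [/eqP ->|]; last exact: ts.
  by move/lt_le_trans/(_ rho_z); rewrite ltxx.
have [lt1 lt2] := midf_lt z_rho.
exists ((`|z| + rho) / 2); split=> //; first exact: le_lt_trans (normr_ge0 z) lt1.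
move=> x; rewrite inE => /orP [/eqP -> //|xs /(ts x xs) xt].
by apply: lt_trans xt _; exact: le_lt_trans tz lt1.
Qed.

Lemma exists_max_norm (K : numFieldType) (s : seq K) (P : K -> Prop) :
  (exists2 z, z \in s & P z) ->
  exists w, [/\ w \in s, P w & forall z, z \in s -> P z -> `|z| <= `|w|].
Proof.
elim: s => [|x s IH] [z]; first by rewrite in_nil.
have [[y ys Py] _ _|noP zs Pz] := pselect (exists2 y, y \in s & P y).
  have [|w [ws Pw wmax]] := IH; first by exists y.
  have [[Px wx]|nx] := pselect (P x /\ `|w| <= `|x|).
    exists x; split=> //; first exact: mem_head.
    move=> t; rewrite inE => /orP [/eqP -> //|ts Pt].
    by apply: le_trans wx; exact: wmax.
  exists w; split=> //; first by rewrite inE ws orbT.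
  move=> t; rewrite inE => /orP [/eqP -> Px|]; last exact: wmax.
  have [//|/ltW wx] := real_leP (normr_real x) (normr_real w).
  by case: nx.
have zx : z = x.
  by move: zs; rewrite inE => /orP [/eqP //|zs]; case: noP; exists z.
exists x; split; rewrite ?mem_head -?zx // => t; rewrite inE => /orP [/eqP -> |ts Pt].
  by rewrite zx.
by case: noP; exists t.
Qed.

(** An analogue for power sums of Pringsheim's theorem on power series with nonnegative
    coefficients. *)
Lemma nneg_power_sum_dominant (R : realType) (S : seq R[i]) (C : R[i] -> {poly R[i]})
    (a : nat -> R) (w : R[i]) :
  uniq S -> 0 \notin S -> (forall n, 0 <= a n) ->
  (forall n, (a n)%:C = \sum_(z <- S) (C z).[n%:R] * z ^+ n) ->
  w \in S -> C w != 0 -> (forall z, z \in S -> C z != 0 -> `|z| <= `|w|) ->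
  `|w| \in S /\ C `|w| != 0.
Proof.
move=> uS S0 a0 aE wS Cw wmax; apply: contrapT => no_pos.
have w0 : w != 0 by apply: contraNneq S0 => <-.
have [sigma [s0 sw sS]] : exists sigma, [/\ 0 < sigma, sigma < `|w| &
    forall z, z \in S -> `|z| < `|w| -> `|z| < sigma].
  by apply: exists_norm_gap; rewrite normr_gt0.
(* Each root is repeated as often as the size of its coefficient, so the product over [r] kills the
   sum and roots with zero coefficient are absent. *)
pose r := flatten [seq nseq (size (C z)) z | z <- S].
have memr z : z \in r -> z \in S /\ C z != 0.
  move/flatten_mapP => [x xS]; rewrite mem_nseq => /andP [sx /eqP ->].
  by rewrite -size_poly_eq0 -lt0n.
have prodr : \prod_(z <- r) ('X - z%:P) = \prod_(z <- S) ('X - z%:P) ^+ size (C z).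
  rewrite big_flatten big_map; apply: eq_bigr => z _.
  by rewrite big_nseq iter_mulr_1.
have [h [c c0 hE]] := poly_act_isolate uS wS w0 Cw.
apply: (@not_geo_bounded _ sigma w c) => //.
suff ab : geo_bounded sigma (fun n => (a n)%:C).
  have [M bM] := geo_bounded_poly_act h s0 ab.
  by exists M => n; rewrite -hE -(eq_poly_act _ aE).
pose dom (z : R[i]) := `|z| == `|w|.
(* Roots of modulus |w| are removed by nonnegative polynomials; the others have modulus below
   [sigma] and supply the bound. *)
apply: (@nneg_geo_bounded _ _ (\prod_(z <- [seq z <- r | ~~ dom z]) ('X - z%:P))
  [seq z <- r | dom z]) => //.
- move=> e; apply: geo_bounded_roots => // z; rewrite mem_filter => /andP [ndz /memr [zS Cz]].
  by apply: sS => //; rewrite lt_neqAle ndz wmax.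
- move=> z; rewrite mem_filter => /andP [/eqP zw /memr [zS Cz]] z0.
  by apply: no_pos; rewrite -zw ger0_norm.
- move=> n; rewrite !big_filter -(bigID dom xpredT) prodr (eq_poly_act _ aE).
  exact: poly_act_power_sum_kill.
Qed.

(** * Recurrence sequences and their expansions *)

Lemma poly_act_sum (K : comNzRingType) (I : Type) (r : seq I) (F : I -> {poly K}) a n :
  poly_act (\sum_(i <- r) F i) a n = \sum_(i <- r) poly_act (F i) a n.
Proof.
elim: r => [|i r IH]; first by rewrite !big_nil -polyC0 poly_actC mul0r.
by rewrite !big_cons poly_actD IH.
Qed.

Lemma poly_act_rec_charpoly (R : realType) (d : nat) (s : 'I_d -> R) (a : nat -> R) :
  satisfies_rec s a -> poly_act (rec_charpoly s) a =1 (fun=> 0).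
Proof.
move=> a_rec n; rewrite /rec_charpoly -mulN1r -polyCN poly_actD poly_actCM mulN1r.
rewrite -['X^d]mul1r poly_act_Xn -polyC1 poly_actC mul1r a_rec poly_act_sum.
apply/eqP; rewrite subr_eq0; apply/eqP/eq_bigr => i _.
by rewrite -mul_polyC poly_act_Xn poly_actC.
Qed.

Lemma rec_charpolyC_neq0 (R : realType) (d : nat) (s : 'I_d -> R) :
  rec_charpolyC s != 0.
Proof.
rewrite map_poly_eq0; apply/eqP => /(congr1 (fun p : {poly R} => p`_d)).
(* The exponents d - (i+1) are below d, so X^d has coefficient 1. *)
rewrite coef0 coefB coefXn eqxx coef_sum big1 ?subr0 => [/eqP|i _].
  by rewrite oner_eq0.
rewrite coefZ coefXn; case: eqP; last by rewrite mulr0.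
by have := ltn_ord i; lia.
Qed.

(** The factor X^m coming from the root 0 acts as a shift by m, so a(n+m) is annihilated by the
    factors of the nonzero roots alone. *)
Lemma power_sum_expansion_exists (R : realType) (d : nat) (s : 'I_d -> R) (a : nat -> R) :
  satisfies_rec s a -> exists C, power_sum_expansion s a C.
Proof.
move=> a_rec; have p0 := rec_charpolyC_neq0 s.
have ann n : poly_act (rec_charpolyC s) (fun k => (a k)%:C) n = 0.
  by rewrite (poly_act_map (real_complex R)) poly_act_rec_charpoly.
rewrite /power_sum_expansion /distinct_roots; set p := rec_charpolyC s in p0 ann *.
case: closed_field_poly_normal => r /= pE.
set m := mup 0 p.
have lc0 : lead_coef p != 0 by rewrite lead_coef_eq0.
have mE : m = count_mem 0 r.
  by rewrite /m pE -mul_polyC mupMr ?mu_prod_XsubC // rootC.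
have prodE : \prod_(z <- r) ('X - z%:P) =
    \prod_(z <- [seq z <- r | z != 0]) ('X - z%:P) * 'X^m.
  rewrite (bigID (fun z => z != 0)) /= big_filter; congr (_ * _).
  rewrite mE (eq_bigr (fun=> 'X)) => [|z]; last by rewrite negbK => /eqP ->; rewrite subr0.
  rewrite big_const_seq iter_mulr_1; congr (_ ^+ _).
  by apply: eq_count => z /=; rewrite negbK.
have [||||C aE] := @power_sum_exists _ [seq z <- undup r | z != 0] [seq z <- r | z != 0]
    (fun n => (a (n + m)%N)%:C).
- by rewrite filter_uniq ?undup_uniq.
- by rewrite mem_filter eqxx.
- by move=> z; rewrite !mem_filter mem_undup.
- move=> n; rewrite (poly_act_shift _ (fun k => (a k)%:C)) -poly_act_Xn -prodE.
  apply: (mulfI lc0); rewrite mulr0 -poly_actCM mul_polyC -pE; exact: ann.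
(* The shift is undone inside the coefficients. *)
exists (fun z => z ^- m *: (C z \Po ('X - m%:R%:P))) => n le_mn.
rewrite -{1}(subnK le_mn) aE big_filter; apply: eq_bigr => z z0.
rewrite hornerZ horner_comp !hornerE -natrB // -mulrA mulrCA; congr (_ * _).
by rewrite -{2}(subnK le_mn) exprD mulrCA mulVf ?mulr1 ?expf_neq0.
Qed.

(** * Positive dominating roots and signs *)

Lemma nneg_dominating_root (R : realType) (d : nat) (s : 'I_d -> R) (a : nat -> R) (N : nat) :
  satisfies_rec s a -> ~ eventually_zero a ->
  (forall n, (N <= n)%N -> 0 <= a n) ->
  exists2 z, dominating_root s a z & 0 < z.
Proof.
move=> a_rec a_nz a0.
set D := distinct_roots (rec_charpolyC s).
have [w [wD wchar wmax]] : exists w, [/\ w \in D, characteristic_root s a w &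
    forall z, z \in D -> characteristic_root s a z -> `|z| <= `|w|].
  (* Some characteristic root exists: otherwise all coefficients of an expansion vanish and [a] is
     eventually zero. *)
  apply: exists_max_norm; have [C aE] := power_sum_expansion_exists a_rec.
  apply: contrapT => noroot; apply: a_nz; exists (mup 0 (rec_charpolyC s)) => n /aE.
  rewrite big1_seq => [|z /andP [z0 zD]]; first by case.
  have [->|Cz] := eqVneq (C z) 0; first by rewrite horner0 mul0r.
  by case: noroot; exists z => //; split=> //; exists C.
have [_ w0 [C aE Cw]] := wchar.
set m := mup 0 (rec_charpolyC s) in aE; pose M := maxn N m.
have sX : size ('X + M%:R%:P : {poly R[i]}) = 2 by rewrite size_XaddC.
(* Coefficients of the sequence shifted by [M], which is nonnegative and given by its expansion from
   n = 0 on. The nonzero ones stay nonzero. *)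
pose C' z := z ^+ M *: (C z \Po ('X + M%:R%:P)).
have C'0 z : z != 0 -> (C' z != 0) = (C z != 0).
  by move=> z0; rewrite scaler_eq0 expf_eq0 (negbTE z0) andbF /= comp_poly2_eq0.
have [||n|n||||] := @nneg_power_sum_dominant _ [seq z <- D | z != 0] C'
    (fun n => a (n + M)%N) w.
- by rewrite filter_uniq ?undup_uniq.
- by rewrite mem_filter eqxx.
- by apply: a0; rewrite (leq_trans (leq_maxl N m)) ?leq_addl.
- rewrite aE ?(leq_trans (leq_maxr N m)) ?leq_addl // big_filter; apply: eq_bigr => z _.
  rewrite hornerZ horner_comp !hornerE -natrD exprD.
  by rewrite mulrA mulrAC [_ * z ^+ M]mulrC.
- by rewrite mem_filter w0.
- by rewrite C'0.
- move=> z; rewrite mem_filter => /andP [z0 zD]; rewrite C'0 // => Cz.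
  by apply: wmax => //; split=> //; exists C.
rewrite mem_filter => /andP [nw0 nwD]; rewrite C'0 // => Cnw.
exists `|w|; last by rewrite normr_gt0.
split; first by split=> //; exists C.
move=> z zchar; rewrite normr_id; apply: wmax => //; by case: zchar.
Qed.

Lemma characteristic_rootN (R : realType) (d : nat) (s : 'I_d -> R) (a b : nat -> R) z :
  (forall n, b n = - a n) -> characteristic_root s a z -> characteristic_root s b z.
Proof.
move=> bE [zD z0 [C aE Cz]]; split=> //; exists (fun x => - C x); last by rewrite oppr_eq0.
move=> n le_mn; rewrite bE rmorphN /= aE // -sumrN.
by apply: eq_bigr => x _; rewrite hornerN mulNr.
Qed.

Lemma recurrence_infinitely_often_neg (R : realType) (d : nat) (s : 'I_d -> R) (a : nat -> R) :
  satisfies_rec s a -> ~ eventually_zero a ->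
  (forall z : R[i], dominating_root s a z -> ~ (0 < z)) ->
  (forall N : nat, exists2 n : nat, (N <= n)%N & a n < 0).
Proof.
move=> a_rec a_nz dom_npos N; apply: contrapT => noneg.
have [n leNn|z zdom z0] := nneg_dominating_root (N := N) a_rec a_nz.
  by rewrite leNgt; apply/negP => an; apply: noneg; exists n.
exact: dom_npos z zdom z0.
Qed.

Theorem mainTheorem1 (R : realType) (d : nat) (s : 'I_d -> R) (a : nat -> R)
    (a_rec : satisfies_rec s a)
    (a_nz : ~ eventually_zero a)
    (dom_le4 : exists2 r : seq R[i], (size r <= 4)%N
                 & forall z : R[i], dominating_root s a z -> z \in r)
    (dom_npos : forall z : R[i], dominating_root s a z -> ~ (0 < z)) :
  (forall N : nat, exists2 n : nat, (N <= n)%N & 0 < a n) /\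
  (forall N : nat, exists2 n : nat, (N <= n)%N & a n < 0).
Proof.
split; last exact: recurrence_infinitely_often_neg a_rec a_nz dom_npos.
(* The positive half is the negative half for -a, which has the same characteristic roots. *)
have b_rec : satisfies_rec s (fun n => - a n).
  by move=> n; rewrite a_rec -sumrN; apply: eq_bigr => i _; rewrite mulrN.
have b_nz : ~ eventually_zero (fun n => - a n).
  move=> [N bN]; apply: a_nz; exists N => n /bN /eqP.
  by rewrite oppr_eq0 => /eqP.
move=> N; have [z [zb zmax]|n leNn] := recurrence_infinitely_often_neg b_rec b_nz _ N.
  apply: dom_npos; split; first by apply: characteristic_rootN zb => n; rewrite opprK.
  by move=> w wa; apply: zmax; apply: characteristic_rootN wa.
by rewrite oppr_lt0 => an; exists n.
Qed.
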